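(* Let $S \subset \mathbb{R}^d$ be a $d$-dimensional simplex with centroid $\mathrm{c}(S) = \boldsymbol{0}$. Then $$\#(S \cap \mathbb{Z}^d) \leq \binom{d + \lceil \lambda_1(S)^{-1}(d+1) \rceil}{d}.$$ Furthermore, if $\lambda_1(S)^{-1} \in \mathbb{N}$, then equality holds if and only if $S$ is unimodularly equivalent to $\lambda_1(S)^{-1} S_d$, where $$S_d = (d+1)\,\mathrm{conv}\{\boldsymbol{0}, \boldsymbol{e}_1, \ldots, \boldsymbol{e}_d\} - \boldsymbol{1} = \{\boldsymbol{x} \in \mathbb{R}^d : x_i \geq -1 \text{ for } 1 \leq i \leq d,\ x_1 + x_2 + \cdots + x_d \leq 1\}.$$
   Context: The centroid of a Lebesgue measurable set $A \subset \mathbb{R}^d$ of positive Lebesgue measure $\mathrm{vol}(A)$ is $\mathrm{c}(A) = \frac{1}{\mathrm{vol}(A)} \int_A \boldsymbol{x} \, \mathrm{d}\boldsymbol{x}$. For a convex body (compact convex set) $K \subset \mathbb{R}^d$ with $\boldsymbol{0}$ in its interior, the first successive minimum is $$\lambda_1(K) = \min\{\lambda \in \mathbb{R}_{>0} : \lambda K \cap \mathbb{Z}^d \neq \{\boldsymbol{0}\}\}.$$ $\boldsymbol{e}_i \in \mathbb{R}^d$ is the $i$th unit vector, $\boldsymbol{1} = (1,\ldots,1) \in \mathbb{R}^d$ is the all ones vector, and $\mathrm{conv}$ denotes the convex hull. $\lceil x \rceil$ is the smallest integer not smaller than $x$. $\mathbb{N}$ denotes the positive integers. Two sets $A, B \subset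 \mathbb{R}^d$ are unimodularly equivalent if $A = UB + \boldsymbol{z}$ for some matrix $U \in \mathbb{Z}^{d \times d}$ with $|\det U| = 1$ and some $\boldsymbol{z} \in \mathbb{Z}^d$. *)

(* Defs.v *)
From HB Require Import structures.
From mathcomp Require Import all_boot all_order all_algebra.
From mathcomp Require Import all_classical all_reals all_analysis.

Set Implicit Arguments.
Unset Strict Implicit.
Unset Printing Implicit Defensive.

Import Order.TTheory GRing.Theory Num.Theory.
Import numFieldNormedType.Exports.

Local Open Scope classical_set_scope.
Local Open Scope ring_scope.

(* The library has Lebesgue measure on R only.  On R^d, realized as
   d-tuples (which carry the product sigma-algebra), it is built by induction
   on d: Dirac mass on R^0, and the image of the product measure under
   (x, t) |-> x :: t for the step. *)
Section lebesgue_cons.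
Local Open Scope ereal_scope.
Context {R : realType} (d : nat)
  (mu : {sigma_finite_measure set (d.-tuple (measurableTypeR R)) -> \bar R}).

Let T := measurableTypeR R.

Definition tcons (p : T * d.-tuple T) : d.+1.-tuple T :=
  [tuple of p.1 :: p.2].

Lemma measurable_tcons : measurable_fun [set: T * d.-tuple T] tcons.
Proof. exact: (measurable_cons measurable_fst measurable_snd). Qed.

Definition lebesgue_cons : set (d.+1.-tuple T) -> \bar R :=
  pushforward (@lebesgue_measure R \x mu) tcons.

Let lebesgue_cons0 : lebesgue_cons set0 = 0.
Proof. by rewrite /lebesgue_cons /pushforward preimage_set0 measure0. Qed.

Let lebesgue_cons_ge0 A : 0 <= lebesgue_cons A.
Proof. exact: (measure_ge0 (@lebesgue_measure R \x mu)). Qed.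

Let lebesgue_cons_sigma_additive : semi_sigma_additive lebesgue_cons.
Proof.
pose m := (@lebesgue_measure R \x mu) : {measure set (T * d.-tuple T) -> \bar R}.
move=> F mF tF mUF; rewrite /lebesgue_cons /pushforward preimage_bigcup.
apply: (@measure_semi_sigma_additive _ _ _ m).
- by move=> n; rewrite -[X in measurable X]setTI; exact: measurable_tcons.
- apply/trivIsetP => /= i j _ _ ij; rewrite -preimage_setI.
  by move/trivIsetP : tF => /(_ _ _ _ _ ij) ->//; rewrite preimage_set0.
- by rewrite -preimage_bigcup -[X in measurable X]setTI; exact: measurable_tcons.
Qed.

HB.instance Definition _ := isMeasure.Build _ _ _ lebesgue_cons
  lebesgue_cons0 lebesgue_cons_ge0 lebesgue_cons_sigma_additive.

Let lebesgue_cons_sigma_finite : sigma_finite setT lebesgue_cons.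
Proof.
have /sigma_finiteP[F [TF ndF Foo]] := sigma_finiteT (@lebesgue_measure R).
have /sigma_finiteP[G [TG ndG Goo]] := sigma_finiteT mu.
pose g (t : d.+1.-tuple T) : T * d.-tuple T := (thead t, [tuple of behead t]).
have gK : cancel g tcons by move=> t; exact/val_inj/esym/(congr1 val (tuple_eta t)).
have Kg : cancel tcons g.
  by case=> x t; congr pair => //; exact: val_inj.
have mg : measurable_fun setT g.
  by apply/measurable_fun_pair; [exact: measurable_tnth|exact: measurable_behead].
exists (fun n => g @^-1` (F n `*` G n)).
  apply/esym; rewrite -subTset => t _.
  have : setT (g t).1 by []. rewrite TF => -[n _ Fn].
  have : setT (g t).2 by []. rewrite TG => -[k _ Gk].
  exists (maxn n k) => //; split.
  - by move: Fn; exact/subsetPset/ndF/leq_maxl.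
  - by move: Gk; exact/subsetPset/ndG/leq_maxr.
move=> n; have [mF Fn] := Foo n; have [mG Gn] := Goo n; split.
  by rewrite -[X in measurable X]setTI; apply: mg => //; exact: measurableX.
rewrite /lebesgue_cons /pushforward -comp_preimage.
rewrite (_ : g \o tcons = id); last by apply/funext => x; exact: Kg.
by rewrite preimage_id product_measure1E// lte_mul_pinfty// ge0_fin_numE.
Qed.

HB.instance Definition _ := Measure_isSigmaFinite.Build _ _ _ lebesgue_cons
  lebesgue_cons_sigma_finite.

End lebesgue_cons.

Fixpoint lebesgue_tuple (R : realType) (d : nat) :
    {sigma_finite_measure set (d.-tuple (measurableTypeR R)) -> \bar R} :=
  match d with
  | 0 => \d_([tuple] : 0.-tuple (measurableTypeR R))
  | d'.+1 => lebesgue_cons (lebesgue_tuple R d')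
  end.

Section euclidean.
Context {R : realType} {d : nat}.
Implicit Types (A B K S : set 'cV[R]_d) (l : R).

Definition col_of_tuple (t : d.-tuple R) : 'cV[R]_d := \col_i tnth t i.

Definition vol A : \bar R := lebesgue_tuple R d (col_of_tuple @^-1` A).

Definition centroid A : 'cV[R]_d :=
  \col_i ((fine (vol A))^-1 *
    \int[lebesgue_tuple R d]_(t in col_of_tuple @^-1` A) tnth t i).

Definition dilate l K : set 'cV[R]_d := [set l *: x | x in K].

Definition Zlattice : set 'cV[R]_d := [set x | x \is a mxOver Num.int].

(* The junk value [point] is taken when X has no least element. *)
Definition minimum (X : set R) : R := get (X `&` lbound X).

Definition lambda1 K : R :=
  minimum [set l | 0 < l /\ dilate l K `&` Zlattice <> [set 0]].

Definition convex_hull A : set 'cV[R]_d := smallest (@convex_set R 'cV[R]_d) A.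

Definition affinely_independent k (v : 'I_k.+1 -> 'cV[R]_d) :=
  forall a : 'I_k.+1 -> R,
    \sum_i a i = 0 -> \sum_i a i *: v i = 0 -> forall i, a i = 0.

Definition is_simplex k S := exists v : 'I_k.+1 -> 'cV[R]_d,
  affinely_independent v /\ S = convex_hull (range v).

Definition std_simplex : set 'cV[R]_d :=
  convex_hull (0 |` range (fun i : 'I_d => delta_mx i 0)).

Definition Sd : set 'cV[R]_d :=
  [set d.+1%:R *: x - const_mx 1 | x in std_simplex].

Definition unimodularly_equivalent A B :=
  exists (U : 'M[int]_d) (z : 'cV[int]_d), `|\det U| = 1 /\
    A = [set map_mx intr U *m x + map_mx intr z | x in B].

Let convE (k : {i01 R}) (y z : convex_lmodType 'cV[R]_d) :
  conv k y z = k%:num *: (y : 'cV[R]_d) + (1 - k%:num) *: (z : 'cV[R]_d).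
Proof. by []. Qed.

Lemma convex_set_sum (C : set 'cV[R]_d) n (a : 'I_n -> R) (v : 'I_n -> 'cV[R]_d) :
  @convex_set R 'cV[R]_d C -> (forall i, 0 <= a i) -> \sum_i a i = 1 ->
  (forall i, C (v i)) -> C (\sum_i a i *: v i).
Proof.
move=> cC; elim: n a v => [|n IH] a v a0 a1 Cv.
  by move: a1; rewrite big_ord0 => /esym/eqP; rewrite oner_eq0.
rewrite big_ord_recl.
have s0 : 0 <= \sum_(i < n) a (lift ord0 i) by apply: sumr_ge0.
move: a1; rewrite big_ord_recl => a1.
have [az|anz] := eqVneq (\sum_(i < n) a (lift ord0 i)) 0.
  rewrite big1 ?addr0.
    by move: a1; rewrite az addr0 => ->; rewrite scale1r; exact: Cv.
  move=> i _; have /eqP := az; rewrite psumr_eq0// => /allP/(_ i).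
  by rewrite mem_index_enum => /(_ isT)/eqP ->; rewrite scale0r.
have := IH (fun i => a (lift ord0 i) / \sum_(i < n) a (lift ord0 i))
  (v \o lift ord0) => /(_ _ _ _) IHv.
have Cs : C (\sum_(i < n) (a (lift ord0 i) / \sum_(i < n) a (lift ord0 i))
    *: v (lift ord0 i)).
  apply: IHv => [i||i]; last exact: Cv.
    by rewrite divr_ge0.
  by rewrite -mulr_suml divff.
have l01 : 0 <= a ord0 <= 1 by rewrite a0/= -a1 lerDl.
have := cC (v ord0) _ (Itv01 (proj1 (andP l01)) (proj2 (andP l01)))
  (mem_set (Cv ord0)) (mem_set Cs) => /set_mem.
rewrite convE/=; congr (C (_ + _)).
rewrite scaler_sumr; apply: eq_bigr => i _; rewrite scalerA; congr (_ *: _).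
by rewrite -a1 [X in X - _]addrC addrK mulrC divfK.
Qed.

Lemma std_simplexE :
  std_simplex = [set x | (forall i, 0 <= x i 0) /\ \sum_i x i 0 <= 1].
Proof.
apply/seteqP; split=> [x|x [x0 x1]].
  pose D := [set y : 'cV[R]_d | (forall i, 0 <= y i 0) /\ \sum_i y i 0 <= 1].
  move=> /(_ D); apply; split.
    apply/convex_setW => y z /set_mem[y0 y1] /set_mem[z0 z1] k k0 k1.
    apply/mem_set; split.
      move=> i; rewrite convE !mxE.
      by rewrite addr_ge0// mulr_ge0// ?subr_ge0 ltW.
    under eq_bigr do rewrite convE !mxE.
    rewrite big_split/= -!mulr_sumr.
    by rewrite -[leRHS](subrKC k%:num) lerD// ler_piMr// ?subr_ge0 ltW.
  move=> _ [->|[i _ <-]]/=.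
    by split=> [i|]; [rewrite mxE|rewrite big1// => i _; rewrite mxE].
  split=> [j|]; first by rewrite mxE; case: eqP.
  rewrite (bigD1 i)//= mxE !eqxx big1 ?addr0// => j ji.
  by rewrite mxE (negbTE ji).
move=> C [cC sC].
pose a := fun i : 'I_d.+1 =>
  if unlift ord0 i is Some j then x j 0 else 1 - \sum_i x i 0.
pose v := fun i : 'I_d.+1 =>
  if unlift ord0 i is Some j then delta_mx j 0 else 0 : 'cV[R]_d.
have -> : x = \sum_i a i *: v i.
  rewrite big_ord_recl /a /v unlift_none scaler0 add0r.
  under eq_bigr do rewrite liftK.
  by rewrite [LHS]matrix_sum_delta; apply: eq_bigr => i _; rewrite big_ord1.
apply: convex_set_sum => //.
- by move=> i; rewrite /a; case: unliftP => // _; rewrite subr_ge0.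
- rewrite big_ord_recl /a unlift_none.
  rewrite [X in _ + X](eq_bigr (fun i => x i 0)) ?subrK// => i _.
  by rewrite liftK.
- move=> i; apply: sC; rewrite /v; case: unliftP => [j _|_]; last by left.
  by right; exists j.
Qed.

Lemma SdE :
  Sd = [set x | (forall i, -1 <= x i 0) /\ \sum_i x i 0 <= 1].
Proof.
have d0 : 0 < d.+1%:R :> R by [].
apply/seteqP; split=> [_ [y + <-]|x [x0 x1]]; rewrite ?std_simplexE/=.
  move=> [y0 y1]; split=> [i|].
    by rewrite !mxE lerBrDl subrr mulr_ge0// ltW.
  under eq_bigr do rewrite !mxE.
  rewrite sumrB -mulr_sumr sumr_const card_ord lerBlDr -nat1r.
  by rewrite ler_piMr.
exists (d.+1%:R^-1 *: (x + const_mx 1)); last first.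
  by rewrite scalerA divff ?gt_eqF// scale1r addrK.
rewrite std_simplexE/=; split=> [i|].
  by rewrite !mxE mulr_ge0 ?invr_ge0 ?(ltW d0)// -lerBlDr sub0r.
under eq_bigr do rewrite !mxE.
rewrite -mulr_sumr big_split/= sumr_const card_ord.
by rewrite ler_pdivrMl// mulr1 -nat1r lerD2r.
Qed.

End euclidean.

Arguments Sd : clear implicits.

(* Main.v *)
From HB Require Import structures.
Require Import Defs.
From mathcomp Require Import all_boot all_order all_algebra.
From mathcomp Require Import all_classical all_reals all_analysis.
From mathcomp Require Import measurable_realfun perm lra.

Set Implicit Arguments.
Unset Strict Implicit.
Unset Printing Implicit Defensive.

Import Order.TTheory GRing.Theory Num.Theory.
Import numFieldNormedType.Exports.

Local Open Scope classical_set_scope.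
Local Open Scope ring_scope.
Local Open Scope card_scope.

(** Let [l] be the first minimum of [S]. In barycentric coordinates the simplex
    is given by [d.+1] inequalities; since the centroid is the origin, all
    coordinates of the origin equal [d.+1%:R^-1]. After rescaling, [S] consists
    of the [x] such that [y_i x >= - l^-1] for [d.+1] linear forms [y_i] of sum
    0, and minimality of [l] says that every nonzero lattice vector [z]
    satisfies [y_i z <= -1] for some [i] ([centered_simplex],
    [lambda1_simplex]).

    Send a lattice point [x] of [S] to the integer parts of [y_i x + l^-1] for
    all [i] but one. If two points [x] and [x'] have the same image, then all
    but one [y_i] take values in (-1, 1) on [x - x'], and the remaining form is
    nonnegative on [x - x'] or on [x' - x]; so one of these two vectors violates
    the above property unless it is 0. The images are [d]-tuples of natural
    numbers of sum at most [d.+1%:R * l^-1], and counting these tuples gives the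
    bound ([lattice_points_le]).

    If [l^-1] is an integer [n] and equality holds, every tuple of sum at most
    [d.+1 * n] is an image. Comparing the lattice points over [k] times and over
    [k - 1] times a unit vector, where [k = d.+1 * n], produces a lattice vector
    on which the [d] recorded forms take the values of that unit vector
    ([dual_lattice_vector]). The injectivity argument also shows that the forms
    are integer valued on the lattice, so together they are a unimodular matrix
    mapping [S] onto [n] times the simplex [Sd] ([equality_unimodular]).
    Conversely, all tuples are attained for [n] times [Sd], and unimodular maps
    preserve the number of lattice points.

    The position of the origin in barycentric coordinates is the analytic part
    ([centroid_barycentric]): exchanging two vertices is an affine map that
    preserves [S], hence it preserves integrals over [S], so all the barycentric
    coordinates have the same integral over [S]. That an affine map preserving
    [S] preserves integrals follows from translation invariance and Tonelli's
    theorem, by the uniqueness argument for Haar measure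
    ([integral_col_affine_symmetry]). *)

(** * Lebesgue measure on tuples: translations and cubes *)

Section lebesgue_tuple_theory.
Local Open Scope ereal_scope.
Context {R : realType}.
Local Notation T := (measurableTypeR R).

Lemma ge0_integral_lebesgue_tuple_cons d (f : d.+1.-tuple T -> \bar R) :
  measurable_fun setT f -> (forall t, 0 <= f t) ->
  \int[lebesgue_tuple R d.+1]_t f t =
  \int[@lebesgue_measure R]_x \int[lebesgue_tuple R d]_t f (tcons (x, t)).
Proof.
move=> mf f0.
rewrite [LHS](@ge0_integral_pushforward _ _ _ _ _ _ (@measurable_tcons R d)
  (@lebesgue_measure R \x lebesgue_tuple R d) setT)//.
rewrite preimage_setT fubini_tonelli1//.
  by apply: measurableT_comp => //; exact: measurable_tcons.
by move=> x; exact: f0.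
Qed.

Lemma lebesgue_measure_shift (h : R) (A : set R) : measurable A ->
  pushforward (@lebesgue_measure R) (fun x : T => (x + h)%R : T) A =
  lebesgue_measure A.
Proof.
have mh : measurable_fun setT (fun x : T => (x + h)%R : T).
  exact: measurable_funD.
move=> mA.
pose Sh := HB.pack (fun x : T => (x + h)%R : T)
  (isMeasurableFun.Build _ _ _ _ _ mh) : {mfun T >-> T}.
apply/esym; rewrite -[RHS]/(pushforward lebesgue_measure Sh A).
apply: lebesgue_measure_unique => //= _ [[a b]] _ <-.
rewrite /pushforward/=.
rewrite (_ : _ @^-1` _ = `](a - h)%R, (b - h)%R]%classic); last first.
  by apply/seteqP; split=> x /=; rewrite !in_itv/= ltrBlDr lerBrDr.
rewrite !lebesgue_measure_itv/= !lte_fin ltrD2r.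
by rewrite -!EFinB opprB addrA subrK.
Qed.

Lemma ge0_integral_lebesgue_shift (h : R) (f : T -> \bar R) :
  measurable_fun setT f -> (forall t, 0 <= f t) ->
  \int[@lebesgue_measure R]_x f (x + h)%R = \int[@lebesgue_measure R]_x f x.
Proof.
move=> mf f0.
have mh : measurable_fun setT (fun x : T => (x + h)%R : T).
  exact: measurable_funD.
transitivity (\int[pushforward (@lebesgue_measure R)
    (fun x : T => (x + h)%R : T)]_x f x).
  by rewrite (ge0_integral_pushforward mh).
by apply: eq_measure_integral => A mA _; exact: lebesgue_measure_shift.
Qed.

Definition tuple_add d (t h : d.-tuple T) : d.-tuple T :=
  [tuple (tnth t i + tnth h i)%R | i < d].

(** By Tonelli the one-dimensional invariance applies to each coordinate in
    turn, whence the induction on the dimension. *)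
Lemma ge0_integral_lebesgue_tuple_shift d (h : d.-tuple T)
    (f : d.-tuple T -> \bar R) :
  measurable_fun setT f -> (forall t, 0 <= f t) ->
  \int[lebesgue_tuple R d]_t f (tuple_add t h) = \int[lebesgue_tuple R d]_t f t.
Proof.
elim: d h f => [|d IH] h f mf f0.
  by apply: eq_integral => t _; rewrite (tuple0 (tuple_add _ _)) (tuple0 t).
have mtadd : measurable_fun setT (fun t : d.+1.-tuple T => tuple_add t h).
  apply/measurable_fun_tnthP => i.
  rewrite [X in measurable_fun _ X](_ : _ =
      fun t : d.+1.-tuple T => (tnth t i + tnth h i)%R).
    by apply: measurable_funD => //; exact: measurable_tnth.
  by apply/funext => t; rewrite /= tnth_mktuple.
rewrite !ge0_integral_lebesgue_tuple_cons//; last exact: measurableT_comp.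
pose F (x : T) := \int[lebesgue_tuple R d]_t f (tcons (x, t)).
have mft : measurable_fun setT (f \o @tcons R d).
  by apply: measurableT_comp => //; exact: measurable_tcons.
have mF : measurable_fun setT F.
  apply: (measurable_fun_fubini_tonelli_F (m2 := lebesgue_tuple R d)
    (f \o @tcons R d)) => // x; exact: f0.
rewrite -[RHS](ge0_integral_lebesgue_shift (thead h) mF); last first.
  by move=> x; exact: integral_ge0.
apply: eq_integral => x _; rewrite /F.
rewrite -[RHS](IH [tuple of behead h]) => [||t]; last exact: f0.
  apply: eq_integral => t _; congr f; apply: eq_from_tnth => i.
  rewrite [in LHS](tuple_eta h) tnth_mktuple.
  have [j ->|->] := unliftP ord0 i; last by rewrite !tnth0.
  by rewrite !tnthS tnth_mktuple.
apply: measurableT_comp => //; apply: measurableT_comp.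
  exact: measurable_tcons.
exact: measurable_fun_pair.
Qed.

Definition cube d (a : d.-tuple T) (e : R) : set (d.-tuple T) :=
  [set t | forall i, (tnth a i - e <= tnth t i <= tnth a i + e)%R].

Lemma cubeS d (a : d.+1.-tuple T) e :
  @tcons R d @^-1` cube a e =
  `[(thead a - e)%R, (thead a + e)%R]%classic `*` cube [tuple of behead a] e.
Proof.
rewrite [X in cube X](tuple_eta a).
apply/seteqP; split=> [[x t] /= xt|[x t] /= [x0 t0] i].
  split=> /=; first by have := xt ord0; rewrite in_itv/= !tnth0.
  by move=> i; have := xt (lift ord0 i); rewrite !tnthS.
have [j ->|->] := unliftP ord0 i; first by rewrite !tnthS; exact: t0.
by move: x0; rewrite /= in_itv/= !tnth0.
Qed.

Lemma measurable_forall_tuple d (J : finType) (P : J -> set (d.-tuple T)) :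
  (forall i, measurable (P i)) -> measurable [set t | forall i, P i t].
Proof.
move=> mP; rewrite (_ : mkset _ = \bigcap_(i in [set: J]) P i).
  by apply: fin_bigcap_measurable.
by apply/seteqP; split=> t /= Pt i; [move=> _|]; exact: Pt.
Qed.

Lemma measurable_cube d (a : d.-tuple T) (e : R) : measurable (cube a e).
Proof.
apply: (measurable_forall_tuple (P := fun i =>
  (fun t : d.-tuple T => tnth t i) @^-1`
    [set x : T | (tnth a i - e <= x <= tnth a i + e)%R])) => i.
rewrite -[X in measurable X]setTI.
apply: measurable_tnth => //.
exact: (measurable_itv `[(tnth a i - e)%R, (tnth a i + e)%R]).
Qed.

(** Used twice: cubes around a simplex bound its volume from above, cubes
    inside it from below. *)
Lemma lebesgue_tuple_cube d (a : d.-tuple T) (e : R) : (0 < e)%R ->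
  lebesgue_tuple R d (cube a e) = ((e *+ 2) ^+ d)%:E.
Proof.
move=> e0; elim: d a => [|d IH] a.
  by rewrite expr0 /= diracE mem_set// => -[].
rewrite [LHS]/= /lebesgue_cons /pushforward cubeS.
rewrite product_measure1E//=; last exact: measurable_cube.
rewrite IH lebesgue_measure_itv/= lte_fin.
rewrite ltrD2l gtrN// -EFinB opprD opprK addrACA subrr add0r.
by rewrite exprS EFinM.
Qed.

End lebesgue_tuple_theory.

(** * Affine symmetries and Lebesgue integrals *)

Section affine_symmetry.
Local Open Scope ereal_scope.
Context {R : realType} {d : nat}.
Local Notation T := (measurableTypeR R).
Local Notation mu := (lebesgue_tuple R d).
Implicit Types (f g : 'cV[R]_d -> \bar R) (L : 'M[R]_d) (w h : 'cV[R]_d).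

Definition tuple_of_col (x : 'cV[R]_d) : d.-tuple T := [tuple x i 0%R | i < d].

Lemma tuple_of_colK : cancel tuple_of_col (@col_of_tuple R d).
Proof. by move=> x; apply/colP => i; rewrite mxE tnth_mktuple. Qed.

Lemma col_of_tupleD (t s : d.-tuple T) :
  col_of_tuple (tuple_add t s) = (col_of_tuple t + col_of_tuple s)%R.
Proof. by apply/colP => i; rewrite !mxE tnth_mktuple. Qed.

Definition colmeasurable f :=
  measurable_fun [set: d.-tuple T] (fun t : d.-tuple T => f (col_of_tuple t)).

Definition integral_col f := \int[mu]_t f (col_of_tuple t).

Lemma colmeasurable_comp d1 (T1 : measurableType d1) f (phi : T1 -> 'cV[R]_d) :
  colmeasurable f -> (forall i, measurable_fun setT (fun u => phi u i 0%R)) ->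
  measurable_fun setT (fun u => f (phi u)).
Proof.
move=> mf mphi.
rewrite [X in measurable_fun _ X](_ : _ =
  (fun t : d.-tuple T => f (col_of_tuple t)) \o
  (fun u => tuple_of_col (phi u))).
  apply: measurableT_comp => //; apply/measurable_fun_tnthP => i.
  rewrite [X in measurable_fun _ X](_ : _ = fun u => phi u i 0%R).
    exact: mphi.
  by apply: funext => u; rewrite /= tnth_mktuple.
by apply: funext => u; rewrite /= tuple_of_colK.
Qed.

Lemma measurable_col_of_tuple (i : 'I_d) :
  measurable_fun [set: d.-tuple T] (fun t : d.-tuple T => col_of_tuple t i 0%R).
Proof.
rewrite [X in measurable_fun _ X](_ : _ = fun t : d.-tuple T => tnth t i).
  exact: measurable_tnth.
by apply/funext => t; rewrite mxE.
Qed.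

Lemma measurable_affine d1 (T1 : measurableType d1) m (L : 'M[R]_(m, d))
    (w : 'cV[R]_m) (phi : T1 -> 'cV[R]_d) :
  (forall i, measurable_fun setT (fun u => phi u i 0%R)) ->
  forall i, measurable_fun setT (fun u => (L *m phi u + w)%R i 0%R).
Proof.
move=> mphi i.
rewrite [X in measurable_fun _ X](_ : _ =
  fun u => (\sum_(j < d) L i j * phi u j 0 + w i 0)%R); last first.
  by apply/funext => u; rewrite !mxE.
apply: measurable_funD => //; apply: measurable_sum => j.
exact: measurable_funM.
Qed.

Lemma integral_col_shift f h : colmeasurable f -> (forall x, 0 <= f x) ->
  integral_col (fun x => f (x + h)%R) = integral_col f.
Proof.
move=> mf f0; rewrite /integral_col.
rewrite -[RHS](ge0_integral_lebesgue_tuple_shift (tuple_of_col h) mf)//.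
by apply: eq_integral => t _; rewrite col_of_tupleD tuple_of_colK.
Qed.

(** Moving the value of an invertible affine map by [h] amounts to moving its
    argument by [invmx L *m h]. *)
Lemma integral_col_shift_affine f L w h : colmeasurable f ->
    (forall x, 0 <= f x) -> L \in unitmx ->
  integral_col (fun y => f (h + (L *m y + w))%R) =
  integral_col (fun y => f (L *m y + w)%R).
Proof.
move=> mf f0 uL.
rewrite -[RHS](@integral_col_shift _ (invmx L *m h)%R) => [||x]//; last first.
  apply: (@colmeasurable_comp _ _ _
    (fun t : d.-tuple T => L *m col_of_tuple t + w)%R mf).
  by apply: measurable_affine; exact: measurable_col_of_tuple.
apply: eq_integral => t _; congr f.
by rewrite mulmxDr mulKVmx// [in RHS]addrAC addrC.
Qed.

Lemma integral_col_exchange (H : 'cV[R]_d -> 'cV[R]_d -> \bar R) :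
  measurable_fun setT (fun p : d.-tuple T * d.-tuple T =>
    H (col_of_tuple p.1) (col_of_tuple p.2)) ->
  (forall x y, 0 <= H x y) ->
  integral_col (fun x => integral_col (H x)) =
  integral_col (fun y => integral_col (H^~ y)).
Proof.
move=> mH H0.
have := @fubini_tonelli _ _ _ _ _ mu mu _ mH.
by apply => p; exact: H0.
Qed.

(** This is the uniqueness argument for Haar measure. With
    [A y = L *m y + w], the double integral of [f x * g (x + A y)] is evaluated
    in both orders. Integrating over [y] first, translation invariance removes
    [x] and leaves the left-hand side. Integrating over [x] first, translation
    by [A y] turns the integrand into [f (x - A y) * g x], and now it is the
    integral of [f (x - A y)] over [y] that does not depend on [x]. *)
Lemma integral_col_convolution f g L w :
  colmeasurable f -> (forall x, 0 <= f x) ->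
  colmeasurable g -> (forall x, 0 <= g x) -> L \in unitmx ->
  integral_col f * integral_col (fun y => g (L *m y + w)%R) =
  integral_col (fun y => f (- (L *m y + w))%R) * integral_col g.
Proof.
move=> mf f0 mg g0 uL.
pose A (y : 'cV[R]_d) := (L *m y + w)%R.
have mc := measurable_col_of_tuple.
have mA d1 (T1 : measurableType d1) (phi : T1 -> 'cV[R]_d) :
    (forall i, measurable_fun setT (fun u => phi u i 0%R)) ->
  forall i, measurable_fun setT (fun u => A (phi u) i 0%R).
  exact: measurable_affine.
have m1 i : measurable_fun setT
    (fun p : d.-tuple T * d.-tuple T => col_of_tuple p.1 i 0%R).
  exact: (measurableT_comp (mc i)).
have m2 i : measurable_fun setT
    (fun p : d.-tuple T * d.-tuple T => col_of_tuple p.2 i 0%R).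
  exact: (measurableT_comp (mc i)).
have mB d1 (T1 : measurableType d1) (phi psi : T1 -> 'cV[R]_d) :
    (forall i, measurable_fun setT (fun u => phi u i 0%R)) ->
    (forall i, measurable_fun setT (fun u => psi u i 0%R)) ->
  forall i, measurable_fun setT (fun u => (phi u - A (psi u))%R i 0%R).
  move=> mphi mpsi i.
  rewrite [X in measurable_fun _ X](_ : _ =
      fun u => (phi u i 0 - A (psi u) i 0)%R).
    by apply: measurable_funB => //; exact: mA.
  by apply/funext => u; rewrite [LHS]mxE [X in (_ + X)%R]mxE.
transitivity (\int[mu]_x \int[mu]_y
    (f (col_of_tuple x) * g (col_of_tuple x + A (col_of_tuple y))%R)).
  rewrite /integral_col muleC -ge0_integralZl//; last first.
    by apply: integral_ge0.
  apply: eq_integral => x _; rewrite ge0_integralZl//; last first.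
    apply: (colmeasurable_comp mg) => i.
    under eq_fun do rewrite mxE.
    by apply: measurable_funD => //; exact: mA.
  rewrite muleC; congr (_ * _).
  by rewrite -[LHS](integral_col_shift_affine w (col_of_tuple x) mg g0 uL).
transitivity (\int[mu]_y \int[mu]_x
    (f (col_of_tuple x) * g (col_of_tuple x + A (col_of_tuple y))%R)).
  apply: (integral_col_exchange
    (H := fun x y => f x * g (x + A y)%R)) => [|x y].
    2: exact: mule_ge0.
  apply: emeasurable_funM.
    exact: (colmeasurable_comp mf).
  apply: (colmeasurable_comp mg) => i.
  under eq_fun do rewrite mxE.
  by apply: measurable_funD => //; exact: mA.
transitivity (\int[mu]_y \int[mu]_x
    (f (col_of_tuple x - A (col_of_tuple y))%R * g (col_of_tuple x))).
  apply: eq_integral => y _.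
  pose F x := f (x - A (col_of_tuple y))%R * g x.
  rewrite -[RHS]/(integral_col F).
  rewrite -(integral_col_shift (A (col_of_tuple y)))//.
  - by apply: eq_integral => x _; rewrite /F addrK.
  - apply: emeasurable_funM => //; apply: (colmeasurable_comp mf) => i.
    under eq_fun do rewrite mxE.
    exact: measurable_funD.
  - by move=> x; exact: mule_ge0.
transitivity (\int[mu]_x \int[mu]_y
    (f (col_of_tuple x - A (col_of_tuple y))%R * g (col_of_tuple x))).
  apply/esym.
  apply: (integral_col_exchange
    (H := fun x y => f (x - A y)%R * g x)) => [|x y].
    2: exact: mule_ge0.
  apply: emeasurable_funM; last exact: (colmeasurable_comp mg).
  by apply: (colmeasurable_comp mf); exact: mB.
rewrite /integral_col -ge0_integralZl//; last exact: integral_ge0.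
apply: eq_integral => x _.
under eq_integral do rewrite muleC.
rewrite ge0_integralZl//; last first.
  by apply: (colmeasurable_comp mf); exact: mB.
rewrite muleC; congr (_ * _).
have uN : (- L)%R \in unitmx by rewrite -scaleN1r unitmxZ// unitrN1.
rewrite -[LHS]/(integral_col (fun y => f (col_of_tuple x - A y)%R)).
transitivity (integral_col (fun y => f (col_of_tuple x + (- L *m y - w))%R)).
  by apply: eq_integral => y _; rewrite /A mulNmx opprD.
rewrite integral_col_shift_affine//.
by apply: eq_integral => y _; rewrite /A mulNmx opprD.
Qed.

(** An affine automorphism changes integrals by a constant factor, and this
    factor is 1 as soon as the automorphism maps one set of finite positive
    volume onto itself. *)
Lemma integral_col_affine_symmetry g L w (D : set 'cV[R]_d) :
  colmeasurable g -> (forall x, 0 <= g x) -> L \in unitmx ->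
  measurable (@col_of_tuple R d @^-1` D : set (d.-tuple T)) ->
  (forall x, D (L *m x + w)%R <-> D x) -> 0 < vol D < +oo ->
  integral_col (fun y => g (L *m y + w)%R) = integral_col g.
Proof.
move=> mg g0 uL mD DA /andP[D0 Doo].
pose f (x : 'cV[R]_d) : \bar R := (\1_D x)%:E.
have f0 x : 0 <= f x by rewrite lee_fin.
have mf : colmeasurable f.
  apply/measurable_EFinP.
  exact: (@measurable_indic _ _ _ _
    (@col_of_tuple R d @^-1` D : set (d.-tuple T))).
have fV : integral_col f = vol D.
  by rewrite /integral_col /f (@integral_indic _ _ _ _ _ measurableT
    (@col_of_tuple R d @^-1` D : set (d.-tuple T)))// setIT.
have fA : integral_col (fun y => f (L *m y + w)%R) = vol D.
  rewrite -fV; apply: eq_integral => t _; rewrite /f !indicE.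
  have -> : ((L *m col_of_tuple t + w)%R \in D) = (col_of_tuple t \in D).
    by apply/idP/idP; rewrite !inE => /DA.
  by [].
have finV : vol D \is a fin_num by rewrite ge0_fin_numE// ltW.
have mulI x y : vol D * x = vol D * y -> x = y.
  by move=> E; apply/le_anti/andP; split; rewrite -(lee_pmul2l finV D0) E.
(* with both functions equal to the indicator of D, the constant in front of
   the right-hand side is found to be the volume of D *)
have /esym := integral_col_convolution w mf f0 mf f0 uL.
rewrite fA fV muleC => /mulI C.
have := integral_col_convolution w mf f0 mg g0 uL.
by rewrite C fV => /mulI.
Qed.

End affine_symmetry.

(** * Barycentric coordinates *)

Section barycentric.
Context {R : realType} {d : nat} (v : 'I_d.+1 -> 'cV[R]_d).

(** The coordinates are kept as an affine map [x |-> A *m x + c]: its linear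
    part [A] measures lattice vectors, its constant part [c] is the position of
    the origin in the simplex. *)
Definition barycentric (A : 'M[R]_(d.+1, d)) (c : 'cV[R]_d.+1) :=
  [/\ forall x, \sum_i (A *m x + c) i 0 = 1,
      forall x, \sum_i (A *m x + c) i 0 *: v i = x &
      forall a : 'I_d.+1 -> R, \sum_i a i = 1 ->
        forall i, (A *m (\sum_j a j *: v j) + c) i 0 = a i].

Hypothesis aff_v : affinely_independent v.

(** Affine independence says that the vectors [(1, v i)] form a basis, that is,
    that they are the columns of an invertible matrix; the coordinates of [x]
    are obtained by applying the inverse to [(1, x)]. *)
Lemma barycentric_exists : exists A c, barycentric A c.
Proof.
pose V : 'M[R]_(d, 1 + d) := \matrix_(i, j) v j i 0.
pose M : 'M[R]_(1 + d) := col_mx (const_mx 1) V.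
have VE (b : 'cV[R]_(1 + d)) : V *m b = \sum_i b i 0 *: v i.
  apply/colP => j; rewrite mxE summxE; apply: eq_bigr => i _.
  by rewrite !mxE mulrC.
have uM : M \in unitmx.
  rewrite -unitmx_tr -row_free_unit; apply: inj_row_free => u.
  move/(congr1 trmx); rewrite trmx_mul trmxK trmx0 mul_col_mx.
  rewrite -[X in _ = X]vsubmxK => /eq_col_mx[].
  rewrite VE => /colP/(_ 0); rewrite !mxE => u1 u2.
  apply/rowP => i; rewrite [RHS]mxE -[u]trmxK mxE.
  apply: (aff_v (a := fun i => u^T i 0)); last by rewrite u2 linear0.
  by rewrite -[RHS]u1; apply: eq_bigr => j _; rewrite [const_mx _ _ _]mxE mul1r.
pose N := invmx M.
exists (rsubmx N : 'M[R]_(d.+1, d)), (lsubmx N : 'cV[R]_d.+1).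
have bE x : rsubmx N *m x + lsubmx N = N *m col_mx 1 x.
  by rewrite -[in RHS](hsubmxK N) mul_row_col mulmx1 addrC.
have [b1 b2] : (forall x, \sum_i (rsubmx N *m x + lsubmx N) i 0 = 1) /\
  (forall x, \sum_i (rsubmx N *m x + lsubmx N) i 0 *: v i = x).
  apply: all_and2 => x; rewrite bE.
  have := mulKVmx uM (col_mx 1 x); rewrite -/N.
  set b := N *m _; rewrite mul_col_mx => /eq_col_mx[+ <-].
  move/colP/(_ 0); rewrite !mxE eqxx => u1; split; last by rewrite VE.
  by rewrite -[RHS]u1; apply: eq_bigr => j _; rewrite [const_mx _ _ _]mxE mul1r.
split=> // a a1 i.
apply/eqP; rewrite -subr_eq0; apply/eqP.
set x := \sum_j a j *: v j.
apply: (aff_v (a := fun i => (rsubmx N *m x + lsubmx N) i 0 - a i)).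
  by rewrite sumrB b1 a1 subrr.
under eq_bigr do rewrite scalerBl.
by rewrite sumrB b2 subrr.
Qed.

Lemma convex_hull_barycentric A c : barycentric A c ->
  convex_hull (range v) = [set x | forall i, 0 <= (A *m x + c) i 0].
Proof.
move=> [b1 b2 b3]; apply/seteqP; split=> [x|x bx].
  apply; split.
    apply/convex_setW => y z /set_mem y0 /set_mem z0 k k0 k1.
    apply/mem_set => i.
    have -> : A *m (conv k y z : 'cV[R]_d) + c =
      k%:num *: (A *m (y : 'cV[R]_d) + c) +
      (1 - k%:num) *: (A *m (z : 'cV[R]_d) + c).
      rewrite [conv k y z : 'cV[R]_d](_ : _ =
        k%:num *: (y : 'cV[R]_d) + (1 - k%:num) *: (z : 'cV[R]_d))//.
      rewrite mulmxDr -!scalemxAr !scalerDr [RHS]addrACA -scalerDl.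
      by rewrite subrKC scale1r.
    rewrite mxE [X in X + _]mxE [X in _ + X]mxE.
    by rewrite addr_ge0// mulr_ge0// ?subr_ge0 ltW.
  move=> _ [j _ <-] i.
  have vE : \sum_k (k == j)%:R *: v k = v j.
    rewrite (bigD1 j)//= eqxx scale1r big1 ?addr0// => k /negbTE ->.
    by rewrite scale0r.
  rewrite -vE b3 ?ler0n//.
  by rewrite (bigD1 j)//= eqxx big1 ?addr0// => k /negbTE ->.
move=> C [cC sC]; rewrite -(b2 x).
by apply: convex_set_sum => // i; apply: sC; exists i.
Qed.

End barycentric.

(** * The centroid of a simplex *)

Section centroid.
Context {R : realType} {d : nat} (v : 'I_d.+1 -> 'cV[R]_d)
  (A : 'M[R]_(d.+1, d)) (c : 'cV[R]_d.+1).
Hypothesis bA : barycentric v A c.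
Local Notation T := (measurableTypeR R).
Local Notation mu := (lebesgue_tuple R d).
Let b (x : 'cV[R]_d) : 'cV[R]_d.+1 := A *m x + c.
Let D : set 'cV[R]_d := [set x | forall i, 0 <= b x i 0].
Let D' : set (d.-tuple T) := @col_of_tuple R d @^-1` D.

Let b1 x : \sum_i b x i 0 = 1. Proof. by case: bA => + _ _; exact. Qed.
Let b2 x : \sum_i b x i 0 *: v i = x. Proof. by case: bA => _ + _; exact. Qed.
Let b3 (a : 'I_d.+1 -> R) : \sum_i a i = 1 ->
  forall i, b (\sum_j a j *: v j) i 0 = a i.
Proof. by case: bA => _ _; exact. Qed.

Let measurable_b i :
  measurable_fun setT (fun t : d.-tuple T => b (col_of_tuple t) i 0).
Proof. by apply: measurable_affine; exact: measurable_col_of_tuple. Qed.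

Let measurable_D : measurable D'.
Proof.
apply: (measurable_forall_tuple (P := fun i =>
  (fun t : d.-tuple T => b (col_of_tuple t) i 0) @^-1` [set x | 0 <= x])) => i.
rewrite -[X in measurable X]setTI; apply: measurable_b => //.
rewrite (_ : mkset _ = `[0, +oo[%classic); first exact: measurable_itv.
by apply/seteqP; split=> x /=; rewrite in_itv/= andbT.
Qed.

Let b_le1 x i : D x -> b x i 0 <= 1.
Proof.
move=> Dx; rewrite -(b1 x) (bigD1 i)//= lerDl.
by apply: sumr_ge0 => j _; exact: Dx.
Qed.

Let M := 1 + \sum_i \sum_j `|v i j 0|.

Let M_gt0 : 0 < M.
Proof.
by rewrite ltr_pwDl// sumr_ge0// => i _; rewrite sumr_ge0.
Qed.

Let D_bounded x j : D x -> `|x j 0| <= M.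
Proof.
move=> Dx; rewrite -[in leLHS](b2 x) summxE.
apply: (le_trans (ler_norm_sum _ _ _)).
rewrite ler_wpDl//; apply: ler_sum => i _.
rewrite mxE normrM (bigD1 j)//= ler_wpDr//.
  by apply: sumr_ge0.
by rewrite ler_piMl// ger0_norm ?b_le1//; exact: Dx.
Qed.

Let vol_lty : (vol D < +oo)%E.
Proof.
apply: (@le_lt_trans _ _ (mu (cube (tuple_of_col 0) M))).
  apply: le_measure; rewrite ?inE//.
    exact: measurable_cube.
  move=> t Dt i; have := D_bounded i Dt.
  by rewrite mxE tnth_mktuple mxE sub0r add0r ler_norml.
by rewrite lebesgue_tuple_cube// ltry.
Qed.

Let vol_gt0 : (0 < vol D)%E.
Proof.
pose n1 : R := d.+1%:R^-1.
have n0 : 0 < n1 by rewrite invr_gt0.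
pose p : 'cV[R]_d := \sum_i n1 *: v i.
have bp i : b p i 0 = n1.
  by apply: (b3 (a := fun=> n1)); rewrite sumr_const card_ord -mulr_natl divff.
pose K := 1 + \sum_i \sum_j `|A i j|.
have K0 : 0 < K by rewrite ltr_pwDl// sumr_ge0// => i _; rewrite sumr_ge0.
pose e := n1 / K.
have e0 : 0 < e by rewrite divr_gt0.
apply: (@lt_le_trans _ _ (mu (cube (tuple_of_col p) e))).
  by rewrite lebesgue_tuple_cube// lte_fin exprn_gt0// mulrn_wgt0.
apply: le_measure; rewrite ?inE//; first exact: measurable_cube.
move=> t pt i; set x := col_of_tuple t.
(* e is so small that b x i 0 stays within n1 of its value n1 at p *)
have xp j : `|x j 0 - p j 0| <= e.
  by rewrite ler_distl; have := pt j; rewrite tnth_mktuple mxE.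
have -> : b x i 0 = n1 + (A *m (x - p)) i 0.
  by rewrite -(bp i) /b mulmxBr !mxE [RHS]addrC addrA subrK.
rewrite -lerBlDl sub0r lerNl.
apply: (le_trans (ler_norm _)); rewrite normrN mxE.
apply: (le_trans (ler_norm_sum _ _ _)).
apply: (@le_trans _ _ (\sum_j `|A i j| * e)).
  apply: ler_sum => j _; rewrite normrM ler_wpM2l//.
  by have := xp j; rewrite !mxE.
rewrite -mulr_suml /e mulrCA ler_piMr ?(ltW n0)// ler_pdivrMr// mul1r.
rewrite /K (bigD1 i)//= addrCA ler_wpDr// addr_ge0// sumr_ge0// => k _.
by rewrite sumr_ge0.
Qed.

Let fine_vol_gt0 : 0 < fine (vol D).
Proof. by rewrite fine_gt0// vol_gt0 vol_lty. Qed.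

Let ge0_term (i : 'I_d.+1) x : 0 <= b x i 0 * \1_D x.
Proof.
rewrite indicE; have [/set_mem/(_ i) ?|_] := boolP (x \in D).
  by rewrite mulr1.
by rewrite mulr0.
Qed.

Let Rintegral_b i : \int[mu]_(t in D') b (col_of_tuple t) i 0 =
  fine (integral_col (fun x => (b x i 0 * \1_D x)%:E)).
Proof.
rewrite /Rintegral integral_mkcond; congr fine; apply: eq_integral => t _.
rewrite patchE indicE -[t \in D']/(col_of_tuple t \in D).
by case: ifP => _; rewrite ?mulr1 ?mulr0.
Qed.

(** The affine map that exchanges the vertices [v i] and [v j] maps the simplex
    onto itself and exchanges the two coordinates. *)
Let Rintegral_b_swap i j : \int[mu]_(t in D') b (col_of_tuple t) i 0 =
  \int[mu]_(t in D') b (col_of_tuple t) j 0.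
Proof.
pose W : 'M[R]_(d, d.+1) := \matrix_(k, l) v l k 0.
pose s := tperm i j.
pose L := W *m row_perm s A; pose w := W *m row_perm s c.
have TE x : L *m x + w = \sum_l b x (s l) 0 *: v l.
  rewrite -mulmxA -mulmxDr; apply/colP => k; rewrite mxE summxE.
  apply: eq_bigr => l _; rewrite mxE [in RHS]mxE mulrC; congr (_ * _).
  rewrite /b row_permE -mulmxA -row_permE [LHS]mxE [X in X + _]mxE.
  by rewrite [X in _ + X]mxE [RHS]mxE.
have bT x l : b (L *m x + w) l 0 = b x (s l) 0.
  rewrite TE (b3 (a := fun l => b x (s l) 0))//.
  by rewrite -[RHS](b1 x) [RHS](reindex_inj (@perm_inj _ s)).
have TT x : L *m (L *m x + w) + w = x.
  rewrite TE -[RHS](b2 x); apply: eq_bigr => l _.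
  by rewrite bT tpermK.
have LL : L *m L = 1%:M.
  apply/trmx_inj/row_matrixP => k; apply/trmx_inj; rewrite -!tr_col !trmxK.
  have := TT (col k 1%:M); have := TT 0.
  rewrite mulmx0 add0r mulmxDr => Lw; rewrite -addrA Lw addr0 mulmxA => <-.
  by rewrite colE mulmxA; rewrite !colE mul1mx.
have [uL _] := mulmx1_unit LL.
have DT x : D (L *m x + w) <-> D x.
  split=> Dx l; last by rewrite bT; exact: Dx.
  by have := Dx (s l); rewrite bT tpermK.
rewrite !Rintegral_b; congr fine.
rewrite -(@integral_col_affine_symmetry _ _ _ L w D _ _ uL measurable_D DT).
- apply: eq_integral => t _; congr (_%:E).
  have DE : ((L *m col_of_tuple t + w) \in D) = (col_of_tuple t \in D).
    by apply/idP/idP; rewrite !inE => /DT.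
  by rewrite bT tpermL !indicE DE.
- apply/measurable_EFinP/measurable_funM; first exact: measurable_b.
  exact: (@measurable_indic _ _ _ _ D').
- by move=> x; rewrite lee_fin.
- by rewrite vol_gt0 vol_lty.
Qed.

Let integrable_coord k : mu.-integrable D' (fun t => (tnth t k)%:E).
Proof.
apply: measurable_bounded_integrable => //.
  by apply: measurable_funTS; exact: measurable_tnth.
exists M; split; first exact: num_real.
move=> y My t Dt; apply: (le_trans _ (ltW My)).
by have := D_bounded k Dt; rewrite mxE.
Qed.

(** The integral over the simplex of the [i]-th coordinate does not depend on
    [i] by symmetry, and equals [c i 0] times the volume because the linear part
    integrates to 0 when the centroid is the origin. So the [d.+1] entries of
    [c] agree, and their sum is 1. *)
Lemma centroid_barycentric : centroid D = 0 -> forall i, c i 0 = d.+1%:R^-1.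
Proof.
move=> c0.
have coord0 k : \int[mu]_(t in D') tnth t k = 0.
  have /colP/(_ k)/eqP := c0.
  by rewrite !mxE mulf_eq0 invr_eq0 gt_eqF//= => /eqP.
have bE i : \int[mu]_(t in D') b (col_of_tuple t) i 0 = c i 0 * fine (vol D).
  have ib k : mu.-integrable D' (fun t => (A i k * tnth t k)%:E).
    by under eq_fun do rewrite EFinM; exact: integrableZl.
  transitivity (\int[mu]_(t in D') (\sum_k A i k * tnth t k + c i 0)).
    apply: eq_Rintegral => t _; rewrite !mxE; congr (_ + _).
    by apply: eq_bigr => k _; rewrite mxE.
  rewrite RintegralD//.
  - rewrite Rintegral_cst// [X in X + _](_ : _ = 0) ?add0r//.
    rewrite /Rintegral; under eq_integral do rewrite -sumEFin.
    rewrite integral_sum//= big1// => k _.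
    under eq_integral do rewrite EFinM.
    rewrite integralZl// -[X in (_ * X)%E]fineK; last exact: integrable_fin_num.
    by rewrite [fine _]coord0 mule0.
  - rewrite (_ : EFin \o _ = fun t => \sum_k (A i k * tnth t k)%:E)%E.
      by apply: integrable_sum => // k _; exact: ib.
    by apply: funext => t; rewrite /= sumEFin.
  - apply: measurable_bounded_integrable => //.
    by exists `|c i 0|; split=> // y cy t _; exact: ltW.
have cE i j : c i 0 = c j 0.
  apply: (mulIf (lt0r_neq0 fine_vol_gt0)).
  by rewrite -!bE; exact: Rintegral_b_swap.
move=> i; have := b1 0; rewrite /b mulmx0 add0r.
rewrite (eq_bigr (fun=> c i 0)) => [|j _]; last exact: cE.
rewrite sumr_const card_ord => c1.
by apply: (mulfI (x := d.+1%:R)); rewrite // mulr_natl c1 divff.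
Qed.

End centroid.

(** * The first successive minimum *)

Section first_minimum.
Context {R : realType} {d : nat} (A : 'M[R]_(d.+1, d)) (W : 'M[R]_(d, d.+1)).
Context (e : R).
Implicit Types (x z : 'cV[R]_d).
Hypothesis WA : W *m A = 1%:M.
Hypothesis sumA : forall x, \sum_i (A *m x) i 0 = 0.
Hypothesis e0 : 0 < e.
Let S : set 'cV[R]_d := [set x | forall i, - e <= (A *m x) i 0].

Let dilateP l x : 0 < l ->
  dilate l S x <-> forall i, - (l * e) <= (A *m x) i 0.
Proof.
move=> l0; split=> [[y Sy <-] i|lx].
  by rewrite -scalemxAr mxE -mulrN ler_pM2l.
exists (l^-1 *: x); last by rewrite scalerA divff ?gt_eqF// scale1r.
by move=> i; rewrite -scalemxAr mxE ler_pdivlMl// mulrN.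
Qed.

(* up to the factor e, the gauge of S: for l > 0, z belongs to l S
   iff h z <= l * e *)
Let h z : R := \big[Num.max/0]_i - (A *m z) i 0.

Let le_h z i : - (A *m z) i 0 <= h z.
Proof. exact: (le_bigmax _ (fun i => - (A *m z) i 0)). Qed.

Let h_le z m : 0 <= m -> (forall i, - m <= (A *m z) i 0) -> h z <= m.
Proof. by move=> m0 zm; apply: bigmax_le => // i _; rewrite lerNl. Qed.

Let h_lt z m : 0 < m -> (forall i, - m < (A *m z) i 0) -> h z < m.
Proof. by move=> m0 zm; apply: bigmax_lt => // i _; rewrite ltrNl. Qed.

Let h_ge0 z : 0 <= h z. Proof. exact: bigmax_ge_id. Qed.

Let norm_le_h z i : `|(A *m z) i 0| <= h z *+ d.+1.
Proof.
have hd : h z <= h z *+ d.+1 by rewrite mulrS lerDl mulrn_wge0.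
rewrite ler_norml lerNl (le_trans (le_h z i) hd)/=.
have -> : (A *m z) i 0 = \sum_(l | l != i) - (A *m z) l 0.
  rewrite sumrN; apply/eqP; rewrite -addr_eq0; apply/eqP.
  by rewrite -[RHS](sumA z) [RHS](bigD1 i).
apply: (@le_trans _ _ (\sum_(l : 'I_d.+1 | l != i) h z)).
  by apply: ler_sum => l _; exact: le_h.
rewrite -[in leRHS](card_ord d.+1) -sumr_const.
rewrite [leRHS](bigID (fun l => l != i))/=.
by rewrite lerDl sumr_ge0.
Qed.

Let h_gt0 z : z <> 0 -> 0 < h z.
Proof.
move=> z0; rewrite lt_neqAle h_ge0 andbT eq_sym; apply/eqP => hz0; apply: z0.
have Az : A *m z = 0.
  apply/colP => i; rewrite [RHS]mxE; apply/eqP; rewrite -normr_le0.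
  by have := norm_le_h z i; rewrite hz0 mul0rn.
by rewrite -[z]mul1mx -WA -mulmxA Az mulmx0.
Qed.

Let K : R := (\sum_j \sum_i `|W j i|) *+ d.+1.

Let coord_le z j : `|z j 0| <= K * h z.
Proof.
rewrite -[z in leLHS]mul1mx -WA -mulmxA mxE.
apply: (le_trans (ler_norm_sum _ _ _)).
apply: (@le_trans _ _ (\sum_i `|W j i| * (h z *+ d.+1))).
  by apply: ler_sum => i _; rewrite normrM ler_wpM2l.
rewrite -mulr_suml mulrnAr /K mulrnAl lerMn2r/= ler_wpM2r//.
by rewrite [leRHS](bigD1 j)//= lerDl sumr_ge0// => l _; rewrite sumr_ge0.
Qed.

Hypothesis hd : (0 < d)%N.

(** Only finitely many lattice vectors have a gauge bounded by that of a fixed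
    one, since their entries are bounded; a minimum over these is a minimum
    over all nonzero lattice vectors. *)
Let minimizer : exists z, [/\ Zlattice z, z <> 0 &
  forall y, Zlattice y -> y <> 0 -> h z <= h y].
Proof.
pose z0 : 'cV[R]_d := delta_mx (Ordinal hd) 0.
have Zz0 : Zlattice z0 by apply/mxOverP => ? ?; rewrite mxE rpred_nat.
have z00 : z0 <> 0.
  by move=> /colP/(_ (Ordinal hd))/eqP; rewrite !mxE !eqxx oner_eq0.
pose N := (Num.truncn (K * h z0)).+1.
(* the lattice points of the box of radius N, indexed by a finite type *)
pose pt (f : {ffun 'I_d -> 'I_N.*2.+1}) : 'cV[R]_d :=
  \col_j ((f j)%:R - N%:R).
have ptP z : Zlattice z -> h z <= h z0 -> exists f, pt f = z.
  move=> /mxOverP Zz hz.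
  have zN j : `|z j 0| < N%:R.
    apply: le_lt_trans (coord_le z j) _.
    apply: le_lt_trans (truncnS_gt _).
    by rewrite ler_wpM2l// mulrn_wge0// sumr_ge0// => l _; rewrite sumr_ge0.
  exists [ffun j => inord (Num.truncn (z j 0 + N%:R))].
  apply/colP => j; rewrite !mxE ffunE.
  have /andP[zl zu] : - N%:R < z j 0 < N%:R by rewrite -ltr_norml.
  have zn : z j 0 + N%:R \is a Num.nat.
    have zi : z j 0 + N%:R \is a Num.int by rewrite rpredD ?rpred_nat ?Zz.
    by rewrite natrEint zi -lerBlDr sub0r ltW.
  rewrite inordK; first by rewrite truncnK// addrK.
  by rewrite ltnS -(ler_nat R) truncnK// -addnn natrD lerD2r ltW.
have [f0 f0E] := ptP z0 Zz0 (lexx _).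
have Pf0 : pt f0 != 0 by rewrite f0E; apply/eqP.
case: (@arg_minP _ _ _ f0 (fun f => pt f != 0) (fun f => h (pt f)) Pf0).
move=> f Pf fmin.
exists (pt f); split; [|exact/eqP|].
  by apply/mxOverP => i j; rewrite mxE rpredB ?rpred_nat.
move=> y Zy y0; have [hy|/ltW hy] := leP (h y) (h z0).
  by have [g gy] := ptP y Zy hy; rewrite -gy fmin// gy; apply/eqP.
by rewrite (le_trans _ hy)// -f0E fmin.
Qed.

(** The minimum that defines [lambda1 S] is attained, hence positive, and a
    nonzero lattice vector cannot be interior to [lambda1 S] times [S]: if all
    inequalities were strict, a smaller dilate would contain it. *)
Lemma lambda1_simplex : 0 < lambda1 S /\
  forall z, Zlattice z -> z <> 0 ->
    exists i, (A *m z) i 0 <= - (lambda1 S * e).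
Proof.
pose X := [set l : R | 0 < l /\ dilate l S `&` Zlattice <> [set 0]].
have dil0 l : 0 < l -> (dilate l S `&` Zlattice) 0.
  move=> l0; split; last by apply/mxOverP => ? ?; rewrite mxE rpred0.
  by apply/dilateP => // i; rewrite mulmx0 mxE oppr_le0 mulr_ge0// ltW.
have XE l : X l <-> 0 < l /\ exists z, [/\ Zlattice z, z <> 0 & h z <= l * e].
  split=> -[l0].
    move=> lS; split=> //; apply: contrapT => nz; apply: lS.
    apply/seteqP; split=> [z [/dilateP lz Zz]|_ ->]; last exact: dil0.
    apply: contrapT => z0; apply: nz; exists z; split=> //.
    by apply: h_le; [rewrite mulr_ge0 ?ltW|exact: lz].
  move=> [z [Zz z0 hz]]; split=> // E; apply: z0.
  rewrite -[z = 0]/([set 0] z) -E; split=> //.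
  by apply/dilateP => // i; rewrite lerNl (le_trans (le_h z i)).
have [z [Zz z0 zmin]] := minimizer.
have [/XE[l0 _] lbX] : (X `&` lbound X) (lambda1 S).
  apply: getPex; exists (h z / e); split.
    apply/XE; split; first by rewrite divr_gt0// h_gt0.
    by exists z; rewrite divfK ?gt_eqF.
  move=> l /XE[l0 [y [Zy y0 hy]]].
  by rewrite ler_pdivrMr// (le_trans _ hy)// zmin.
split=> // y Zy y0; apply: contrapT => ny.
have hy : h y < lambda1 S * e.
  apply: h_lt => [|i]; first exact: mulr_gt0.
  by rewrite ltNge; apply/negP => yi; apply: ny; exists i.
have : lambda1 S <= h y / e.
  apply: lbX; apply/XE; split; first by rewrite divr_gt0// h_gt0.
  by exists y; rewrite divfK ?gt_eqF.
by rewrite ler_pdivlMr// leNgt hy.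
Qed.

End first_minimum.

(** * Counting the lattice points of a separated simplex *)

Lemma card_finset (X : finType) (B : {set X}) : [set` B] #= `I_#|B|.
Proof.
have <- : (index^~ (enum B)) @` [set` B] = `I_#|B|.
  apply/seteqP; split=> [_ [x xB <-]|n nB] /=.
    by rewrite cardE index_mem mem_enum.
  have [x0 _] : exists x, x \in B.
    by apply/set0Pn; rewrite -card_gt0; case: (#|B|) nB.
  rewrite /= cardE in nB.
  exists (nth x0 (enum B) n); last by rewrite index_uniq// enum_uniq.
  by rewrite /= -mem_enum mem_nth.
rewrite card_eq_sym; apply: inj_card_eq => x y /set_mem/= xB /set_mem/= yB.
by move=> /(congr1 (nth x (enum B))); rewrite !nth_index// mem_enum.
Qed.

Definition bounded_sum (m k : nat) : {set m.-tuple 'I_k.+1} :=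
  finset (fun t : m.-tuple 'I_k.+1 => (\sum_(i <- t) i <= k)%N).

Section separated.
Context {R : realType} {d : nat} (Y : 'M[R]_d) (r : R).
Implicit Types (x z : 'cV[R]_d).

(** For [0 < r], the preimage of [dilate r (Sd R d)] under [Y], see
    [dilate_SdE]. *)
Definition simplex_of : set 'cV[R]_d :=
  [set x | (forall j, - r <= (Y *m x) j 0) /\ \sum_j (Y *m x) j 0 <= r].

(** The interior of [simplex_of 1] contains no lattice point other than 0. *)
Definition lattice_separated := forall z, Zlattice z ->
  (forall j, -1 < (Y *m z) j 0) -> \sum_j (Y *m z) j 0 < 1 -> z = 0.

Lemma ZlatticeB x z : Zlattice x -> Zlattice z -> Zlattice (x - z).
Proof.
move=> /mxOverP xZ /mxOverP zZ; apply/mxOverP => i j.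
by rewrite mxE [X in _ + X]mxE rpredB.
Qed.

Hypothesis sepY : lattice_separated.

(** The condition on the last facet is met for free: the sum of the coordinates
    of [Y *m y] is nonpositive for [y = x - z] or for [y = z - x]. This is why
    only [d] of the [d.+1] facets have to be recorded in [code] below. *)
Lemma separated_eq x z : Zlattice x -> Zlattice z ->
  (forall j, `|(Y *m x) j 0 - (Y *m z) j 0| < 1) -> x = z.
Proof.
move=> Zx Zz xz1.
wlog le0 : x z Zx Zz xz1 / \sum_j (Y *m (x - z)) j 0 <= 0.
  move=> wl; have [le0|/ltW ge0] := leP (\sum_j (Y *m (x - z)) j 0) 0.
    exact: wl.
  apply/esym/wl => // [j|]; first by rewrite distrC.
  rewrite -opprB mulmxN; under eq_bigr do rewrite mxE.
  by rewrite sumrN oppr_le0.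
apply/eqP; rewrite -subr_eq0; apply/eqP.
apply: sepY; first exact: ZlatticeB.
  move=> j; rewrite mulmxBr mxE [X in _ + X]mxE.
  by have := xz1 j; rewrite ltr_norml => /andP[].
exact: le_lt_trans le0 ltr01.
Qed.

Context (k : nat).
Hypothesis rk : d.+1%:R * r <= k%:R.

(** The integer parts of the distances of [x] to the first [d] facets, measured
    in units in which these facets lie at distance [r] from the origin. *)
Definition code x : d.-tuple 'I_k.+1 :=
  [tuple inord (Num.truncn ((Y *m x) j 0 + r)%R) | j < d].

Lemma sum_truncn_le x : simplex_of x ->
  (\sum_j Num.truncn ((Y *m x) j 0 + r)%R <= k)%N.
Proof.
move=> [xj xs]; rewrite -(ler_nat R) natr_sum; apply: le_trans rk.
apply: (@le_trans _ _ (\sum_j ((Y *m x) j 0 + r))).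
  by apply: ler_sum => j _; rewrite truncn_le -lerBlDr sub0r.
rewrite big_split/= sumr_const card_ord -natr1 mulrDl mul1r mulr_natl addrC.
by rewrite lerD2l.
Qed.

Lemma tnth_code x j : simplex_of x ->
  tnth (code x) j = Num.truncn ((Y *m x) j 0 + r)%R :> nat.
Proof.
move=> /sum_truncn_le sk; rewrite tnth_mktuple inordK// ltnS.
by apply: leq_trans sk; rewrite (bigD1 j)//= leq_addr.
Qed.

Lemma code_bounded x : simplex_of x -> code x \in bounded_sum d k.
Proof.
move=> Sx; rewrite inE big_tuple.
by under eq_bigr do rewrite tnth_code//; exact: sum_truncn_le.
Qed.

Lemma code_itv x j : simplex_of x ->
  (tnth (code x) j)%:R <= (Y *m x) j 0 + r < (tnth (code x) j).+1%:R.
Proof.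
move=> Sx; rewrite tnth_code// truncn_itv// -lerBlDr sub0r.
by case: Sx.
Qed.

Lemma code_inj : {in simplex_of `&` Zlattice &, injective code}.
Proof.
move=> x z /set_mem[Sx Zx] /set_mem[Sz Zz] xz; apply: separated_eq => // j.
have := code_itv j Sx; have := code_itv j Sz; rewrite xz.
move=> /andP[z1 z2] /andP[x1 x2].
rewrite ltr_distl; move: z1 z2 x1 x2; rewrite -natr1; lra.
Qed.

Let codes : {set d.-tuple 'I_k.+1} :=
  finset (fun t => `[< exists2 x, (simplex_of `&` Zlattice) x & code x = t >]).

Let codesE : [set` codes] = code @` (simplex_of `&` Zlattice).
Proof.
apply/seteqP; split=> t /=; rewrite inE.
  by move=> /asboolP[x ? <-]; exists x.
by case=> x Sx xt; apply/asboolP; exists x.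
Qed.

Let codes_sub : codes \subset bounded_sum d k.
Proof.
apply/fintype.subsetP => t; rewrite inE => /asboolP[x [Sx _] <-].
exact: code_bounded.
Qed.

Let card_codes : simplex_of `&` Zlattice #= `I_#|codes|.
Proof.
have := card_finset codes; rewrite codesE => /(card_eq_trans _); apply.
by rewrite card_eq_sym; exact: inj_card_eq code_inj.
Qed.

Lemma lattice_points_le : simplex_of `&` Zlattice #<= `I_('C(d + k, d)).
Proof.
rewrite -card_partial_ord_partitions (card_le_eql card_codes) card_le_II.
exact: subset_leq_card.
Qed.

(** Extremality is used only through this surjectivity of [code]. *)
Lemma lattice_points_eqP : simplex_of `&` Zlattice #= `I_('C(d + k, d)) <->
  (forall t, t \in bounded_sum d k ->
    exists2 x, (simplex_of `&` Zlattice) x & code x = t).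
Proof.
rewrite -card_partial_ord_partitions (card_eql card_codes).
split=> [/card_eq_II E t|H].
  rewrite -(eqP (_ : codes == bounded_sum d k)); last first.
    by rewrite eqEcard codes_sub E leqnn.
  by rewrite inE => /asboolP.
rewrite (_ : codes = bounded_sum d k)//; apply/eqP.
rewrite finset.eqEsubset codes_sub; apply/fintype.subsetP => t /H[x Sx xt].
by rewrite inE; apply/asboolP; exists x.
Qed.

End separated.

(** * Integer matrices and the standard simplex *)

Section integer_simplex.
Context {R : realType} {d : nat}.
Implicit Types (x z : 'cV[R]_d) (Y : 'M[R]_d).

Lemma unitz_norm (m : int) : (m \is a GRing.unit) = (`|m| == 1).
Proof. by rewrite eqr_norml ler01 andbT. Qed.

Lemma mxOver_intr m n (M : 'M[R]_(m, n)) : M \is a mxOver Num.int ->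
  M = map_mx intr (map_mx (@Num.floor R) M).
Proof.
move=> /mxOverP Mint; apply/matrixP => i j; rewrite !mxE.
by apply/esym/eqP; rewrite -intrEfloor.
Qed.

Lemma mxOver_map_intr m n (M : 'M[int]_(m, n)) :
  (map_mx intr M : 'M[R]_(m, n)) \is a mxOver Num.int.
Proof. by apply/mxOverP => i j; rewrite mxE intr_int. Qed.

Lemma mxOver_int_mul m n p (M : 'M[R]_(m, n)) (N : 'M[R]_(n, p)) :
  M \is a mxOver Num.int -> N \is a mxOver Num.int ->
  M *m N \is a mxOver Num.int.
Proof.
move=> /mxOver_intr -> /mxOver_intr ->; rewrite -map_mxM.
exact: mxOver_map_intr.
Qed.

Lemma dilate_SdE (r : R) : 0 < r -> dilate r (Sd R d) = simplex_of 1%:M r.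
Proof.
move=> r0; rewrite SdE; apply/seteqP; split=> [_ [x [x1 xs] <-]|x []].
  split=> [j|]; rewrite mul1mx.
    by rewrite mxE -mulrN1 ler_pM2l.
  by under eq_bigr do rewrite mxE; rewrite -mulr_sumr ler_piMr// ltW.
rewrite mul1mx => xj xs; exists (r^-1 *: x); last first.
  by rewrite scalerA divff ?gt_eqF// scale1r.
split=> [j|].
  by rewrite mxE -ler_pdivrMl ?invr_gt0// invrK mulrN1.
under eq_bigr do rewrite mxE.
by rewrite -mulr_sumr ler_pdivrMl// mulr1.
Qed.

Lemma separated1 : lattice_separated (1%:M : 'M[R]_d).
Proof.
move=> z /mxOverP zZ; rewrite mul1mx => z1 zs.
have z0 j : 0 <= z j 0.
  have /intrP[m zm] := zZ j 0; move: (z1 j); rewrite zm.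
  by rewrite (ltr_int _ (-1)) (ler_int _ 0) -lezD1 addNr.
apply/colP => j; rewrite mxE; apply/eqP; rewrite eq_le z0 andbT.
have : z j 0 < 1.
  by apply: le_lt_trans zs; rewrite (bigD1 j)//= lerDl sumr_ge0.
have /intrP[m ->] := zZ j 0.
by rewrite (ltr_int _ _ 1) (ler_int _ _ 0) -ltzD1 add0r.
Qed.

Lemma dilation_bound n : d.+1%:R * n%:R <= ((d.+1 * n)%N)%:R :> R.
Proof. by rewrite natrM. Qed.

(** For the standard simplex [code] is translation by [n], which is onto. *)
Lemma card_standard n :
  simplex_of (1%:M : 'M[R]_d) n%:R `&` Zlattice #= `I_('C(d + d.+1 * n, d)).
Proof.
apply/(lattice_points_eqP separated1 (dilation_bound n)) => t.
rewrite inE big_tuple => tk.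
pose x : 'cV[R]_d := \col_j ((tnth t j)%:R - n%:R).
have Zx : Zlattice x by apply/mxOverP => i j; rewrite mxE rpredB ?rpred_nat.
exists x; first split=> //.
  split=> [j|]; rewrite mul1mx; first by rewrite mxE lerBrDl subrr.
  under eq_bigr do rewrite mxE.
  rewrite sumrB -natr_sum sumr_const card_ord lerBlDr.
  by rewrite -mulrnA -natrD ler_nat (leq_trans tk)// mulSn mulnC.
apply: eq_from_tnth => j; apply: val_inj.
by rewrite tnth_mktuple mul1mx mxE subrK natrK /= inordK.
Qed.

Lemma unimodular_card (U : 'M[int]_d) (w : 'cV[int]_d) (B : set 'cV[R]_d) :
  `|\det U| = 1 ->
  [set map_mx intr U *m x + map_mx intr w | x in B] `&` Zlattice #=
  B `&` Zlattice.
Proof.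
move=> U1.
have uU : U \in unitmx by rewrite unitmxE unitz_norm U1.
have UK : map_mx intr (invmx U) *m map_mx intr U = 1%:M :> 'M[R]_d.
  by rewrite -map_mxM mulVmx// map_mx1.
have -> : [set map_mx intr U *m x + map_mx intr w | x in B] `&` Zlattice =
    (fun x => map_mx intr U *m x + map_mx intr w) @` (B `&` Zlattice).
  apply/seteqP; split=> [_ [[x Bx <-]] Zx|_ [x [Bx Zx] <-]].
    exists x => //; split => //.
    have := ZlatticeB Zx (mxOver_map_intr w); rewrite addrK.
    move/(mxOver_int_mul (mxOver_map_intr (invmx U))).
    by rewrite mulmxA UK mul1mx.
  split; first by exists x.
  have := ZlatticeB (mxOver_int_mul (mxOver_map_intr U) Zx)
    (mxOver_map_intr (- w)).
  by rewrite map_mxN opprK.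
apply: inj_card_eq => x z _ _ /addIr /(congr1 (mulmx (map_mx intr (invmx U)))).
by rewrite !mulmxA UK !mul1mx.
Qed.

End integer_simplex.

(** * The equality case *)

Section equality_case.
Context {R : realType} {d : nat} (Y : 'M[R]_d) (n : nat).
Implicit Types (x z : 'cV[R]_d).
Hypothesis sepY : lattice_separated Y.
Hypothesis n0 : (0 < n)%N.
Local Notation r := (n%:R : R).
Local Notation k := (d.+1 * n)%N.
Local Notation S := (simplex_of Y r).
Hypothesis full : S `&` Zlattice #= `I_('C(d + k, d)).

Let realize (a : 'I_d -> nat) : (\sum_j a j <= k)%N ->
  exists x, [/\ Zlattice x, S x &
    forall j, (a j)%:R <= (Y *m x) j 0 + r < (a j).+1%:R].
Proof.
move=> ak; pose t : d.-tuple 'I_k.+1 := [tuple inord (a j) | j < d].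
have tE j : tnth t j = a j :> nat.
  rewrite tnth_mktuple inordK// ltnS (leq_trans _ ak)//.
  by rewrite (bigD1 j)//= leq_addr.
have tk : t \in bounded_sum d k.
  by rewrite inE big_tuple; under eq_bigr do rewrite tE.
have [x [Sx Zx] xt] := (lattice_points_eqP sepY (dilation_bound n)).1 full t tk.
exists x; split=> // j.
by have := code_itv (dilation_bound n) j Sx; rewrite xt tE.
Qed.

Let k_gt0 : (0 < k)%N. Proof. by rewrite muln_gt0. Qed.

Let kE : k%:R = r + r *+ d :> R.
Proof. by rewrite mulSn natrD mulnC natrM mulr_natr. Qed.

(** Write [e_i] for [delta_mx i 0]. The lattice point [p] with code [k e_i] is a
    vertex of the simplex; let [q] be the one with code [(k - 1) e_i]. On their
    difference [z] the [i]-th form lies in (0, 1] and the others in (-1, 0].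
    Separation applied to [- z] gives the value 1 for the former, applied to [z]
    it then gives 0 for the others. *)
Lemma dual_lattice_vector i : exists2 z, Zlattice z & Y *m z = delta_mx i 0.
Proof.
pose a m (j : 'I_d) := if j == i then m else 0%N.
have suma m : (\sum_j a m j = m)%N.
  rewrite (bigD1 i)//= {1}/a eqxx big1 ?addn0// => j /negbTE ji.
  by rewrite /a ji.
have [p [Zp [_ Sp] ap]] := realize (eq_leq (suma k)).
have [q [Zq [_ Sq] aq]] : exists x, [/\ Zlattice x, S x &
    forall j, (a k.-1 j)%:R <= (Y *m x) j 0 + r < (a k.-1 j).+1%:R].
  by apply: realize; rewrite suma leq_pred.
(* the integer parts of the coordinates of p already have the largest possible
   sum k, so these coordinates are integers *)
have pE j : (Y *m p) j 0 = (a k j)%:R - r.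
  apply/eqP; rewrite eq_le lerBlDr (proj1 (andP (ap j))) andbT lerBrDr.
  rewrite leNgt; apply/negP => lt_a.
  have : \sum_l ((a k l)%:R : R) < \sum_l ((Y *m p) l 0 + r).
    rewrite (bigD1 j)//= [ltRHS](bigD1 j)//= ltr_leD//.
    by apply: ler_sum => l _; have /andP[] := ap l.
  rewrite -natr_sum suma big_split/= sumr_const card_ord kE.
  by rewrite ltrD2r ltNge Sp.
pose z := p - q.
have Zz : Zlattice z by exact: ZlatticeB.
have zE j : (Y *m z) j 0 = (Y *m p) j 0 - (Y *m q) j 0.
  by rewrite mulmxBr mxE [X in _ + X]mxE.
have kp : (k.-1)%:R = k%:R - 1 :> R by rewrite -subn1 natrB.
have zi : 0 < (Y *m z) i 0 <= 1.
  have := aq i; rewrite zE pE /a eqxx prednK// kp; lra.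
have zj j : j != i -> -1 < (Y *m z) j 0 <= 0.
  move=> /negbTE ji; have := aq j; rewrite zE pE /a ji; lra.
have sz0 : 0 <= \sum_j (Y *m z) j 0.
  rewrite (eq_bigr (fun j => (a k j)%:R - r - (Y *m q) j 0)) => [|j _].
    rewrite !sumrB -natr_sum suma sumr_const card_ord kE.
    by move: Sq; lra.
  by rewrite zE pE.
have znz : z <> 0.
  by move=> z0; move: zi; rewrite z0 mulmx0 mxE ltxx.
have zi1 : (Y *m z) i 0 = 1.
  apply/eqP; rewrite eq_le (proj2 (andP zi))/= leNgt; apply/negP => zi1.
  apply: znz; apply/eqP; rewrite -oppr_eq0; apply/eqP; apply: sepY.
  - by have := ZlatticeB (mxOver_map_intr 0) Zz; rewrite map_mx0 sub0r.
  - move=> j; rewrite mulmxN mxE ltrN2.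
    have [->//|/zj/andP[_ /le_lt_trans]] := eqVneq j i; exact.
  - rewrite mulmxN; under eq_bigr do rewrite mxE.
    by rewrite sumrN (le_lt_trans _ ltr01)// oppr_le0.
have sz1 : 1 <= \sum_j (Y *m z) j 0.
  rewrite leNgt; apply/negP => sz1; apply: znz; apply: sepY => // j.
  have [->|/zj/andP[]//] := eqVneq j i.
  by rewrite zi1; lra.
exists z => //; apply/colP => j; rewrite [RHS]mxE eqxx andbT.
have [->|ji] := eqVneq j i; first exact: zi1.
apply/eqP; rewrite eq_le (proj2 (andP (zj _ ji)))/=.
rewrite leNgt; apply/negP => zj0; move: sz1.
rewrite leNgt (bigD1 i)//= zi1 -ltrBrDl subrr (bigD1 j)//=.
rewrite (le_lt_trans _ zj0)// gerDl sumr_le0// => l /andP[li _].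
by have /andP[] := zj _ li.
Qed.

(** The vectors of [dual_lattice_vector] are the columns of an integer inverse
    [Z] of [Y]. Conversely [Y] is integer valued on the lattice: if [f] is the
    integer vector obtained by rounding down [Y *m x], the images under [Y] of
    the lattice points [x] and [Z *m f] differ by less than 1 in each
    coordinate, so the two points coincide. *)
Lemma equality_unimodular : unimodularly_equivalent S (dilate r (Sd R d)).
Proof.
have [z Zz zE] : exists2 z : 'I_d -> 'cV[R]_d,
    (forall i, Zlattice (z i)) & forall i, Y *m z i = delta_mx i 0.
  have [z zP] := choice (fun i =>
    let: ex_intro2 z Zz Yz := dual_lattice_vector i in
    ex_intro _ z (conj Zz Yz)).
  by exists z => i; case: (zP i).
pose Z : 'M[R]_d := \matrix_(k, i) z i k 0.
have colZ i : col i Z = z i by apply/colP => l; rewrite !mxE.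
have YZ : Y *m Z = 1%:M.
  apply/matrixP => l i; rewrite (_ : _ l i = col i (Y *m Z) l 0); last first.
    by rewrite [RHS]mxE.
  by rewrite colE -mulmxA -colE colZ zE !mxE andbT.
have ZZ : Z \is a mxOver Num.int.
  by apply/mxOverP => l i; rewrite mxE; apply: (mxOverP (Zz i)).
have ZY : Z *m Y = 1%:M by exact: mulmx1C.
have Yint x : Zlattice x -> Zlattice (Y *m x).
  move=> Zx; pose f : 'cV[int]_d := \col_j Num.floor ((Y *m x) j 0).
  have ZF : Zlattice (Z *m map_mx intr f).
    exact: mxOver_int_mul ZZ (mxOver_map_intr f).
  rewrite (separated_eq sepY Zx ZF) => [|j].
    by rewrite mulmxA YZ mul1mx; exact: mxOver_map_intr.
  rewrite mulmxA YZ mul1mx [X in _ - X]mxE [f _ _]mxE ger0_norm.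
    by have := floor_itv ((Y *m x) j 0); rewrite intrD; lra.
  by rewrite subr_ge0 floor_le.
have YY : Y \is a mxOver Num.int.
  have Ydelta i : Zlattice (Y *m delta_mx i 0).
    by apply: Yint; apply/mxOverP => ? ?; rewrite mxE rpred_nat.
  apply/mxOverP => l i; have /mxOverP/(_ l 0) := Ydelta i.
  by rewrite -colE mxE.
have ZE := mxOver_intr ZZ; have YE := mxOver_intr YY.
set U := map_mx _ Z in ZE; set V := map_mx _ Y in YE.
have VU : V *m U = 1%:M.
  have : map_mx intr (V *m U) = map_mx intr 1%:M :> 'M[R]_d.
    by rewrite map_mxM -ZE -YE map_mx1.
  move=> /matrixP E; apply/matrixP => l i; have := E l i.
  by rewrite !mxE => /intr_inj.
exists U, 0; split.
  have [_] := mulmx1_unit VU; rewrite unitmxE unitz_norm; exact/eqP.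
rewrite -ZE map_mx0 dilate_SdE ?ltr0n//.
apply/seteqP; split=> [x Sx|_ [x [xj xs] <-]].
  exists (Y *m x); last by rewrite mulmxA ZY mul1mx addr0.
  by rewrite /simplex_of/= mul1mx.
by move: xj xs; rewrite addr0 /simplex_of/= mulmxA YZ mul1mx.
Qed.

End equality_case.

(** * Simplices centered at the origin *)

Section centered_simplex.
Context {R : realType} {d : nat}.

Lemma barycentric_linear (v : 'I_d.+1 -> 'cV[R]_d) A c : barycentric v A c ->
  (forall x : 'cV[R]_d, \sum_i (A *m x) i 0 = 0) /\
  (\matrix_(j < d, i < d.+1) v i j 0) *m A = 1%:M.
Proof.
move=> [b1 b2 _]; set W := \matrix_(_, _) _; split=> [x|].
  have := b1 x; rewrite -[in RHS](b1 0) mulmx0 add0r.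
  under eq_bigr do rewrite mxE.
  by rewrite big_split/= => /eqP; rewrite -subr_eq0 addrK => /eqP.
have WE x : W *m (A *m x + c) = x.
  rewrite -[RHS](b2 x); apply/colP => j; rewrite mxE summxE.
  by apply: eq_bigr => i _; rewrite [W _ _]mxE [RHS]mxE mulrC.
have Wc : W *m c = 0 by rewrite -[RHS](WE 0) mulmx0 add0r.
apply/matrixP => l i; rewrite (_ : _ l i = col i (W *m A) l 0); last first.
  by rewrite [RHS]mxE.
rewrite colE -mulmxA -[W *m _]addr0 -[X in _ + X]Wc -mulmxDr WE.
by rewrite -[delta_mx _ _]mul1mx -colE mxE.
Qed.

(** Centering gives every facet the same distance [d.+1%:R^-1] from the origin
    in barycentric coordinates, so that a single rescaling of these coordinates
    makes [S] a dilate of [simplex_of Y 1]. The scale is chosen such that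
    separation expresses the minimality of [lambda1 S]. *)
Lemma centered_simplex (S : set 'cV[R]_d) : (0 < d)%N -> is_simplex d S ->
  centroid S = 0 -> 0 < lambda1 S /\
  exists2 Y, lattice_separated Y & S = simplex_of Y (lambda1 S)^-1.
Proof.
move=> hd [v [av SE]] cS.
have [A [c bA]] := barycentric_exists av.
have SbE : S = [set x | forall i, 0 <= (A *m x + c) i 0].
  by rewrite SE; exact: convex_hull_barycentric.
have cE i : c i 0 = d.+1%:R^-1.
  by apply: (centroid_barycentric bA); rewrite -SbE.
have e0 : 0 < d.+1%:R^-1 :> R by rewrite invr_gt0.
have [sA WA] := barycentric_linear bA.
have SAE : S = [set x | forall i, - d.+1%:R^-1 <= (A *m x) i 0].
  rewrite SbE; apply/seteqP; split=> x /= Sx i; have := Sx i.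
    by rewrite mxE cE -lerBlDr sub0r.
  by rewrite [X in _ -> _ <= X]mxE cE -lerBlDr sub0r.
have [] := lambda1_simplex WA sA e0 hd; rewrite -SAE.
set l := lambda1 S => l0 sep; split=> //.
pose m := l / d.+1%:R; have m0 : 0 < m by rewrite divr_gt0.
have lm : l^-1 = m^-1 * d.+1%:R^-1.
  by rewrite /m invf_div mulrAC divff// mul1r.
pose Y : 'M[R]_d := m^-1 *: row' ord0 A.
have YE (z : 'cV[R]_d) j : (Y *m z) j 0 = (A *m z) (lift ord0 j) 0 / m.
  rewrite -scalemxAl mxE mulrC; congr (_ / _).
  by rewrite !mxE; apply: eq_bigr => i _; rewrite !mxE.
have sY (z : 'cV[R]_d) : \sum_j (Y *m z) j 0 = - (A *m z) ord0 0 / m.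
  under eq_bigr do rewrite YE.
  rewrite -mulr_suml; congr (_ / _); apply/eqP; rewrite -addr_eq0 addrC.
  by have := sA z; rewrite big_ord_recl => ->.
exists Y => [z Zz z1 zs|].
  apply: contrapT => z0; have [i] := sep z Zz z0; rewrite -/m.
  have [j ->|->] := unliftP ord0 i.
    by have := z1 j; rewrite YE ltr_pdivlMr// mulN1r ltNge => /negP.
  by move: zs; rewrite sY ltr_pdivrMr// mul1r ltrNl ltNge => /negP.
rewrite SAE lm; apply/seteqP; split=> x /=.
  move=> Sx; split=> [j|]; last first.
    by rewrite sY mulrC ler_pM2l ?invr_gt0// lerNl; exact: Sx.
  by rewrite YE -mulrN mulrC ler_pM2r ?invr_gt0//; exact: Sx.
move=> [xj xs] i; have [j ->|->] := unliftP ord0 i.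
  by have := xj j; rewrite YE -mulrN mulrC ler_pM2r ?invr_gt0.
by move: xs; rewrite sY mulrC ler_pM2l ?invr_gt0// lerNl.
Qed.

End centered_simplex.

(** * The lattice point bound *)

Theorem theorem1p1 (R : realType) (d : nat) (hd : (0 < d)%N)
    (S : set 'cV[R]_d) (hS : is_simplex d S) (hc : centroid S = 0) :
  let N := 'C(d + `|Num.ceil ((lambda1 S)^-1 * d.+1%:R)|%N, d) in
  (S `&` Zlattice #<= `I_N) /\
  ((exists2 n : nat, (0 < n)%N & (lambda1 S)^-1 = n%:R) ->
   ((S `&` Zlattice #= `I_N) <->
    unimodularly_equivalent S (dilate (lambda1 S)^-1 (Sd R d)))).
Proof.
have [l0 [Y sepY SE]] := centered_simplex hd hS hc.
set r := (lambda1 S)^-1 in SE *.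
have r0 : 0 < r by rewrite invr_gt0.
have kE : `|Num.ceil (r * d.+1%:R)|%:R = (Num.ceil (r * d.+1%:R))%:~R :> R.
  rewrite natr_absz ger0_norm// -(ler_int R) (le_trans _ (ceil_ge _))//.
  by rewrite mulr_ge0// ltW.
split.
  rewrite SE; apply: lattice_points_le => //.
  by rewrite mulrC kE ceil_ge.
move=> [n n0 rn].
have -> : `|Num.ceil (r * d.+1%:R)|%N = (d.+1 * n)%N.
  by rewrite rn mulrC -natrM -[_%:R]/((_%:Z)%:~R) intrKceil.
rewrite rn in SE *; split=> [|[U [w [U1 ->]]]].
  by rewrite SE; exact: equality_unimodular.
rewrite dilate_SdE ?ltr0n//.
exact: card_eq_trans (unimodular_card _ _ U1) (card_standard _).
Qed.
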